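(* Let $V$ be a vector space. (1) Every partially associative $n$-algebra $(V,\mathfrak m)$ carries a pre Lie $n$-algebra structure $\mathfrak p$ defined by $$\mathfrak p(x_1,\dots,x_n):=\sum_{\sigma\in\mathbb{S}_{n-1}}sgn(\sigma)\,\mathfrak m(x_{\sigma(1)},\dots,x_{\sigma(n-1)},x_n).$$ (2) Every pre Lie $n$-algebra $(V,\mathfrak p)$ carries a Lie $n$-algebra structure $\mathfrak l$ defined by $$\mathfrak l(x_1,\dots,x_n):=\sum_{\sigma\in Sh(n-1,1)}sgn(\sigma)\,\mathfrak p(x_{\sigma(1)},\dots,x_{\sigma(n)}).$$
   Context: All vector spaces are (ungraded) over a field $\mathbb{K}$ of characteristic $0$. $I_k$ is the identity of $\otimes^kV$. For $\sigma\in\mathbb{S}_k$, $\rho_\sigma(x_1\otimes\cdots\otimes x_k)=sgn(\sigma)\,x_{\sigma(1)}\otimes\cdots\otimes x_{\sigma(k)}$, extended linearly to $\mathbb{K}\mathbb{S}_k$; $w_k=\sum_{\sigma\in\mathbb{S}_k}\sigma$. $Sh(n-1,1)$ is the set of $\sigma\in\mathbb{S}_n$ with $\sigma(1)<\cdots<\sigma(n-1)$. For a vector space $V$ and linear $\mu:\otimes^nV\to V$, $(V,\mu)$ is: - a partially associative $n$-algebra if $\sum_{i=0}^{n-1}(-1)^{i(n-1)}\mu\circ(I_i\otimes\mu\otimes I_{n-1-i})=0$; - a pre Lie $n$-algebra if $\mu=\mu\circ(\rho_\sigma\otimes I_1)$ for all $\sigma\in\mathbb{S}_{n-1}$ and $\sum_{i=0}^{n-1}\frac{(-1)^{i(n-1)}}{((n-1)!)^2}\mu\circ(I_i\otimes\mu\otimes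 I_{n-1-i})\circ(\rho_{w_{2n-2}}\otimes I_1)=0$; - a Lie $n$-algebra if $\mu=\mu\circ\rho_\sigma$ for all $\sigma\in\mathbb{S}_n$ and $\sum_{i=0}^{n-1}\frac{(-1)^{i(n-1)}}{(n-1)!\,n!}\mu\circ(I_i\otimes\mu\otimes I_{n-1-i})\circ\rho_{w_{2n-1}}=0$. *)

(* Defs.v *)
From HB Require Import structures.
From mathcomp Require Import all_boot all_order all_fingroup all_algebra.

Set Implicit Arguments.
Unset Strict Implicit.
Unset Printing Implicit Defensive.

Import GRing.Theory.
Local Open Scope ring_scope.

(* A linear map from the k-th tensor power of V to V is represented by the    *)
(* multilinear map {ffun 'I_k -> V} -> V that it induces, and precomposition  *)
(* with a linear map of tensor powers by its effect on pure tensors.          *)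
(* Arguments are numbered from 0, and the (positive) arity of an operation is *)
(* written n.+1; for N = n.+1, the usual 2N-1 and 2N-2 are (n + n).+1 and     *)
(* n + n, and N-1 is n.                                                       *)

Section Operations.

Variables (K : fieldType) (V : lmodType K).

Definition upd k (x : {ffun 'I_k -> V}) (i : 'I_k) (u : V) : {ffun 'I_k -> V} :=
  [ffun j => if j == i then u else x j].

Definition multilinear k (f : {ffun 'I_k -> V} -> V) : Prop :=
  forall (x : {ffun 'I_k -> V}) (i : 'I_k), linear (fun u => f (upd x i u)).

Definition permute k (s : 'S_k) (x : {ffun 'I_k -> V}) : {ffun 'I_k -> V} :=
  [ffun j => x (s j)].

(* f \o rho_s *)
Definition comp_rho k (s : 'S_k) (f : {ffun 'I_k -> V} -> V)
    (x : {ffun 'I_k -> V}) : V :=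
  (-1) ^+ s *: f (permute s x).

(* f \o rho_{w_k}, where w_k is the sum of all permutations *)
Definition comp_rho_w k (f : {ffun 'I_k -> V} -> V)
    (x : {ffun 'I_k -> V}) : V :=
  \sum_(s : 'S_k) comp_rho s f x.

Definition ffun_rcons k (x : {ffun 'I_k -> V}) (v : V) : {ffun 'I_k.+1 -> V} :=
  [ffun j => if unlift ord_max j is Some i then x i else v].

Definition ffun_belast k (x : {ffun 'I_k.+1 -> V}) : {ffun 'I_k -> V} :=
  [ffun i => x (lift ord_max i)].

(* If T is precomposition with g, then comp_tens_id T f is f \o (g (x) I_1):  *)
(* apply T to f with its last argument frozen.                                *)
Definition comp_tens_id k
    (T : ({ffun 'I_k -> V} -> V) -> {ffun 'I_k -> V} -> V)
    (f : {ffun 'I_k.+1 -> V} -> V) (x : {ffun 'I_k.+1 -> V}) : V :=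
  T (fun y => f (ffun_rcons y (x ord_max))) (ffun_belast x).

(* mu \o (I_i (x) mu (x) I_(n - i)):                                          *)
(*   mu (x_0, .., x_(i-1), mu (x_i, .., x_(i+n)), x_(i+n+1), .., x_(2n)).     *)
(* Both uses of inord are in range.                                           *)
Definition self_comp n (mu : {ffun 'I_n.+1 -> V} -> V) (i : 'I_n.+1)
    (x : {ffun 'I_(n + n).+1 -> V}) : V :=
  mu [ffun j : 'I_n.+1 =>
        if (j < i)%N then x (inord j)
        else if j == i then mu [ffun k : 'I_n.+1 => x (inord (i + k))]
        else x (inord (j + n))].

Definition partially_associative n (mu : {ffun 'I_n.+1 -> V} -> V) : Prop :=
  multilinear mu /\
  forall x : {ffun 'I_(n + n).+1 -> V},
    \sum_(i < n.+1) (-1) ^+ (i * n) *: self_comp mu i x = 0.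

Definition pre_lie n (mu : {ffun 'I_n.+1 -> V} -> V) : Prop :=
  [/\ multilinear mu,
      forall s : 'S_n, mu =1 comp_tens_id (comp_rho s) mu
    & forall x : {ffun 'I_(n + n).+1 -> V},
        \sum_(i < n.+1) ((-1) ^+ (i * n) / (n`!%:R ^+ 2)) *:
          comp_tens_id (@comp_rho_w (n + n)) (self_comp mu i) x = 0].

Definition lie n (mu : {ffun 'I_n.+1 -> V} -> V) : Prop :=
  [/\ multilinear mu,
      forall s : 'S_n.+1, mu =1 comp_rho s mu
    & forall x : {ffun 'I_(n + n).+1 -> V},
        \sum_(i < n.+1) ((-1) ^+ (i * n) / (n`!%:R * (n.+1)`!%:R)) *:
          comp_rho_w (self_comp mu i) x = 0].

Definition pre_lie_product n (m : {ffun 'I_n.+1 -> V} -> V)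
    (x : {ffun 'I_n.+1 -> V}) : V :=
  \sum_(s : 'S_n)
    (-1) ^+ s *: m (ffun_rcons (permute s (ffun_belast x)) (x ord_max)).

(* Sh(n, 1): permutations of {0, .., n} increasing on {0, .., n-1} *)
Definition shuffles n : {set 'S_n.+1} :=
  [set s : 'S_n.+1 |
    [forall i : 'I_n.+1, forall j : 'I_n.+1,
      (i < j < n)%N ==> (s i < s j)%N]].

Definition lie_product n (p : {ffun 'I_n.+1 -> V} -> V)
    (x : {ffun 'I_n.+1 -> V}) : V :=
  \sum_(s in shuffles n) (-1) ^+ s *: p (permute s x).

End Operations.

(* Main.v *)
(* Write mu \o_i mu for the composite self_comp mu i, with N = n.+1 arguments   *)
(* for mu. Precomposing the inner or the outer factor with a permutation       *)
(* amounts to permuting the 2N-1 variables of the composite; for the outer     *)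
(* factor this moves the inner block from position i to some position j, at    *)
(* the cost of a sign (-1)^((i + j) n) beyond the signature. Antisymmetrizing  *)
(* over a group H that contains all these permutations therefore gives, for    *)
(* L f = \sum_(s in S) f \o rho_s,                                             *)
(*   \sum_i (-1)^(i n) Alt_H (L f \o_i L f)                                    *)
(*     = |S|^2 Alt_H (\sum_j (-1)^(j n) f \o_j f).                             *)
(* With S and H the stabilizers of the last argument, this is (1). With S the  *)
(* shuffles and H the whole symmetric group, it reduces the Lie identity to    *)
(* the pre-Lie one, since averaging over the stabilizer first changes Alt_H    *)
(* only by a factor, which is invertible in characteristic 0.                  *)

Require Import Defs.
From mathcomp Require Import all_boot all_order all_fingroup all_algebra.
From mathcomp Require Import zify.

Set Implicit Arguments.
Unset Strict Implicit.
Unset Printing Implicit Defensive.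

Import GRing.Theory.
Local Open Scope ring_scope.

(** The identity announced above is [antisym_self_comp]; both halves of the theorem rest on it. Its
    ingredients are [comp_at_rhol] and [comp_at_rhor], which trade a permutation of the outer or
    inner operation for one of the variables of the composite, built by [block_perm_exists] and
    [perm_extension]. The extra sign arises because moving a block of [n.+1] variables past one
    variable takes [n] transpositions more than moving a single variable; the coefficients
    [(-1) ^+ (i * n)] compensate exactly for this. For (2), [antisym_lie_product] also shows that
    [n]![times the shuffle sum is the full antisymmetrization, whence the antisymmetry of the
    bracket after division by]n[!]. *)

(** * Extending and lifting permutations *)

Lemma perm_extension (T1 T2 : finType) (h : T1 -> T2) (s : {perm T1}) :
  injective h ->
  exists A : {perm T2},
    [/\ forall k, A (h k) = h (s k), forall y, y \notin codom h -> A y = y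
      & odd_perm A = odd_perm s].
Proof.
(* Transpositions are transported along [h] one by one, so the number of factors, hence the parity,
   is kept. *)
move=> injh; case: (prod_tpermP s) => ts -> _.
elim: ts => [|t ts [A [Ah Afix Aodd]]].
  by exists 1%g; rewrite big_nil; split=> [k|y _|]; rewrite ?perm1 ?odd_perm1.
exists (tperm (h t.1) (h t.2) * A)%g; rewrite big_cons; split=> [k|y yh|].
- by rewrite !permM -inj_tperm // Ah.
- rewrite permM tpermD ?Afix //; apply: contraNneq yh => <-; exact: codom_f.
- by rewrite !odd_permM !odd_tperm (inj_eq injh) Aodd.
Qed.

Lemma lift_permP n (i : 'I_n.+1) (s : 'S_n.+1) :
  exists t : 'S_n, s = lift_perm i (s i) t.
Proof.
(* The default [k] is never taken, since [s (lift i k)] differs from [s i]. *)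
pose f k := odflt k (unlift (s i) (s (lift i k))).
have fE k : lift (s i) (f k) = s (lift i k).
  have : s i != s (lift i k) by rewrite (inj_eq perm_inj) neq_lift.
  by rewrite /f; case/unlift_some=> l -> ->.
have injf : injective f.
  by move=> k l /(congr1 (lift (s i))); rewrite !fE => /perm_inj/lift_inj.
exists (perm injf); apply/permP=> k.
by have [l ->|->] := unliftP i k;
  rewrite ?lift_perm_lift ?lift_perm_id ?permE ?fE.
Qed.

Lemma lift_perm_inj n (i j : 'I_n.+1) : injective (@lift_perm n i j).
Proof.
move=> s t /permP est; apply/permP=> k.
by apply: (@lift_inj _ j); rewrite -!(lift_perm_lift i) est.
Qed.

Lemma val_liftP n (i : 'I_n.+1) (k : 'I_n) :
  (k < i)%N /\ nat_of_ord (lift i k) = k \/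
  (i <= k)%N /\ nat_of_ord (lift i k) = k.+1.
Proof. by rewrite /= /bump; case: leqP; [right | left]. Qed.

(** * Permuting the variables of a composite blockwise *)

Section Blocks.

Variable n : nat.
Implicit Types (i j k : 'I_n.+1) (t : 'S_n.+1) (B : 'S_(n + n).+1).

(* In a composite at i of two operations of arity n.+1, the argument k of the *)
(* outer one (for k != i) is the variable slot i k, and the argument k of the *)
(* inner one is the variable entry i k.                                       *)
Definition slot i k : 'I_(n + n).+1 :=
  inord (if (k <= i)%N then nat_of_ord k else (k + n)%N).
Definition entry i k : 'I_(n + n).+1 := inord (i + k)%N.

Lemma val_slot i k :
  nat_of_ord (slot i k) = if (k <= i)%N then nat_of_ord k else (k + n)%N.
Proof. by rewrite /= inordK //; case: ifP; have := ltn_ord k; lia. Qed.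

Lemma val_slotP i k :
  (k <= i)%N /\ nat_of_ord (slot i k) = k \/
  (i < k)%N /\ nat_of_ord (slot i k) = (k + n)%N.
Proof. by rewrite val_slot; case: leqP; [left | right]. Qed.

Lemma val_entry i k : nat_of_ord (entry i k) = (i + k)%N.
Proof. by rewrite /= inordK //; have := ltn_ord k; have := ltn_ord i; lia. Qed.

Lemma entry_inj i : injective (entry i).
Proof.
by move=> k l /(congr1 val); rewrite /= !val_entry => /addnI/val_inj.
Qed.

Lemma slot_inj i : injective (slot i).
Proof.
move=> k l /(congr1 val); rewrite /= !val_slot => e; apply: val_inj => /=.
by move: e; case: ifP; case: ifP; have := ltn_ord k; have := ltn_ord l;
  have := ltn_ord i; lia.
Qed.

Lemma slot_notin_entry i k : k != i -> slot i k \notin codom (entry i).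
Proof.
move=> ki; apply/codomP=> -[l] /(congr1 val); rewrite /= val_slot val_entry.
move: ki; rewrite -val_eqE /=.
by case: ifP; have := ltn_ord k; have := ltn_ord l; lia.
Qed.

(* B carries the block of the composite at i onto the block of the composite  *)
(* at j = t i, without reordering it, and permutes the other variables as t.  *)
Definition block_perm i j t B :=
  [/\ t i = j, forall k, k != i -> B (slot i k) = slot j (t k),
      forall k, B (entry i k) = entry j k
    & odd_perm B = odd_perm t (+) odd ((i + j) * n)].

(** With [block_permV], this makes block permutations a groupoid over the block positions, so that
    existence need only be checked on generators. *)
Lemma block_permM i j k t u B C :
  block_perm i j t B -> block_perm j k u C ->
  block_perm i k (t * u)%g (B * C)%g.
Proof.
move=> [ti Bs Be Bo] [uj Cs Ce Co]; split=> [|l li|l|].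
- by rewrite permM ti.
- by rewrite !permM Bs // Cs // -ti (inj_eq perm_inj).
- by rewrite permM Be Ce.
- rewrite !odd_permM Bo Co addbACA !oddM !oddD -andb_addl.
  by congr (_ (+) _ && _); case: (odd i); case: (odd j); case: (odd k).
Qed.

Lemma block_permV i j t B : block_perm i j t B -> block_perm j i t^-1%g B^-1%g.
Proof.
move=> [ti Bs Be Bo]; split=> [|l lj|l|].
- by rewrite -ti permK.
- apply: (@perm_inj _ B); rewrite permKV Bs ?permKV //.
  by apply: contraNneq lj => e; rewrite -ti -e permKV.
- by apply: (@perm_inj _ B); rewrite permKV Be.
- by rewrite !odd_permV Bo addnC.
Qed.

(** The block stays in place: extend the action of [t] on the other slots by the identity on the
    block. *)
Lemma block_perm_fix i t : t i = i -> exists B, block_perm i i t B.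
Proof.
move=> ti; have [u tE] := lift_permP i t.
have injh : injective (fun k : 'I_n => slot i (lift i k)).
  by move=> k l /slot_inj/lift_inj.
have [B [Bh Bfix Bodd]] := perm_extension u injh; exists B; split=> // [k|k|].
- case: (unliftP i k) => [l ->|->]; last by rewrite eqxx.
  by rewrite Bh tE ti lift_perm_lift.
- rewrite Bfix //; apply/codomP => -[l e].
  have /negP[] : slot i (lift i l) \notin codom (entry i).
    by apply: slot_notin_entry; rewrite eq_sym neq_lift.
  by rewrite -e codom_f.
- by rewrite Bodd tE ti odd_lift_perm oddM oddD !addbb addFb addbF.
Qed.

Lemma block_perm_step i j :
  j = i.+1 :> nat -> exists B, block_perm i j (lift_perm i j 1) B.
Proof.
move=> ji; have [ltjn ltin] := (ltn_ord j, ltn_ord i).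
(* The variable just after the block jumps to position [i], in front of it. This cycle is a product
   of [n.+1] adjacent transpositions, while [lift_perm i j 1] is a single one. *)
pose p : 'I_(n + n).+1 := inord (i + n.+1)%N.
pose q : 'I_(n + n).+1 := inord i.
have pE : p = (i + n.+1)%N :> nat by rewrite inordK //; lia.
have qE : q = i :> nat by rewrite inordK //; lia.
move: p q pE qE => p q pE qE.
exists (lift_perm p q 1); split=> [|k|k|].
- by rewrite lift_perm_id.
- case: (unliftP i k) => [l ->|->]; last by rewrite eqxx.
  move=> _; rewrite lift_perm_lift perm1; apply: ord_inj.
  have := val_liftP i l; have := val_liftP j l.
  have := val_slotP i (lift i l); have := val_slotP j (lift j l).
  case: (unliftP p (slot i (lift i l))) => [r|] ->.
    rewrite lift_perm_lift perm1.
    by have := val_liftP p r; have := val_liftP q r; lia.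
  by rewrite lift_perm_id; lia.
- apply: ord_inj; have := ltn_ord k; have := val_entry i k;
  have := val_entry j k.
  case: (unliftP p (entry i k)) => [r|] ->; last by lia.
  rewrite lift_perm_lift perm1.
  by have := val_liftP p r; have := val_liftP q r; lia.
- rewrite !odd_lift_perm pE qE ji !oddM !oddD /= !odd_perm1.
  by case: (odd i); case: (odd n).
Qed.

Lemma block_perm_exists i t : exists B, block_perm i (t i) t B.
Proof.
have from0 j : exists B, block_perm ord0 j (lift_perm ord0 j 1) B.
  case: j => m; elim: m => [|m IHm] ltm.
    rewrite (_ : Ordinal ltm = ord0); last exact: val_inj.
    by apply: block_perm_fix; rewrite lift_perm_id.
  have [B HB] := IHm (ltnW ltm).
  have [C HC] := @block_perm_step (Ordinal (ltnW ltm)) (Ordinal ltm) erefl.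
  by exists (B * C)%g; have := block_permM HB HC; rewrite lift_permM mulg1.
(* Factor [t] as [u^-1 * (u * t * v^-1) * v], where the middle factor fixes [ord0] and the outer
   ones move the block from [i] to [ord0] and from [ord0] to [t i]. *)
have [B HB] := from0 i; have [C HC] := from0 (t i).
set u := lift_perm _ _ _ in HB; set v := lift_perm _ _ _ in HC.
have fix0 : (u * t * v^-1)%g ord0 = ord0.
  by rewrite !permM lift_perm_id -[X in v^-1%g X](lift_perm_id ord0 _ 1) permK.
have [D HD] := block_perm_fix fix0.
exists (B^-1 * (D * C))%g.
have := block_permM (block_permV HB) (block_permM HD HC).
by rewrite mulgKV mulgA mulVg mul1g.
Qed.

Lemma slot_max i : i != ord_max -> slot i ord_max = ord_max.
Proof.
move=> im; apply: val_inj; rewrite /= val_slot /=.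
by move: im; rewrite -val_eqE /=; case: leqP => //; have := ltn_ord i; lia.
Qed.

Lemma entry_max : entry ord_max ord_max = ord_max.
Proof. by apply: val_inj; rewrite /= val_entry. Qed.

(** The last variable is the last slot, or the last entry of the block when the block sits at the
    end; [B] respects both descriptions. *)
Lemma block_perm_max i j t B :
  block_perm i j t B -> t ord_max = ord_max -> B ord_max = ord_max.
Proof.
move=> [ti Bs Be _] tm; have [im|im] := eqVneq i ord_max.
  have jm : j = ord_max by rewrite -ti im.
  by rewrite -[in LHS]entry_max -im Be jm im entry_max.
have jm : j != ord_max by rewrite -ti -tm (inj_eq perm_inj).
by rewrite -[in LHS](slot_max im) Bs 1?eq_sym // tm slot_max.
Qed.

End Blocks.

Section Multilinear.

Variables (K : fieldType) (V : lmodType K).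

(** * Signed permutation action and antisymmetrization *)

Section Antisymmetrization.

Variable k : nat.
Implicit Types (f : {ffun 'I_k -> V} -> V) (x : {ffun 'I_k -> V}) (s t : 'S_k).

Definition antisym (S : {set 'S_k}) f x : V := \sum_(s in S) comp_rho s f x.

Lemma comp_rhoM s t f x : comp_rho (s * t) f x = comp_rho t (comp_rho s f) x.
Proof.
rewrite /comp_rho scalerA -signr_addb odd_permM addbC; congr (_ *: f _).
by apply/ffunP=> i; rewrite !ffunE permM.
Qed.

Lemma eq_comp_rho s f g : f =1 g -> comp_rho s f =1 comp_rho s g.
Proof. by move=> efg x; rewrite /comp_rho efg. Qed.

(** Left translation by [t] permutes [H]; [comp_rho_antisym] uses right translation instead, because
    [comp_rho] is a right action. *)
Lemma antisym_comp_rho (H : {group 'S_k}) t f x :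
  t \in H -> antisym H (comp_rho t f) x = antisym H f x.
Proof.
move=> Ht; rewrite [RHS](reindex_inj (mulgI t)).
by apply: eq_big => [s|s _]; rewrite ?groupMl // comp_rhoM.
Qed.

Lemma comp_rho_antisym (H : {group 'S_k}) t f x :
  t \in H -> comp_rho t (antisym H f) x = antisym H f x.
Proof.
move=> Ht; rewrite [RHS](reindex_inj (mulIg t)) /comp_rho scaler_sumr.
apply: eq_big => [s|s _]; first by rewrite groupMr.
by rewrite [in RHS]/= -/(comp_rho (s * t) f x) comp_rhoM.
Qed.

Lemma eq_antisym S f g : f =1 g -> antisym S f =1 antisym S g.
Proof. by move=> efg x; apply: eq_bigr => s _; apply: eq_comp_rho. Qed.

Lemma antisym_sum (I : finType) (P : pred I) S
    (F : I -> {ffun 'I_k -> V} -> V) x :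
  antisym S (fun y => \sum_(i | P i) F i y) x =
  \sum_(i | P i) antisym S (F i) x.
Proof.
by rewrite /antisym exchange_big; apply: eq_bigr => s _; apply: scaler_sumr.
Qed.

Lemma antisymZ S c f x : antisym S (fun y => c *: f y) x = c *: antisym S f x.
Proof.
rewrite /antisym scaler_sumr; apply: eq_bigr => s _.
by rewrite /comp_rho !scalerA mulrC.
Qed.

Lemma multilinear_comp_rho s f : multilinear f -> multilinear (comp_rho s f).
Proof.
move=> linf x i a u v.
have permute_upd w : permute s (upd x i w) = upd (permute s x) (s^-1 i)%g w.
  by apply/ffunP=> j; rewrite !ffunE -[in RHS](inj_eq (@perm_inj _ s)) permKV.
by rewrite /comp_rho !permute_upd linf scalerDr !scalerA mulrC.
Qed.

Lemma multilinear_antisym S f : multilinear f -> multilinear (antisym S f).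
Proof.
move=> linf x i a u v; rewrite /antisym scaler_sumr -big_split.
by apply: eq_bigr => s _; rewrite multilinear_comp_rho.
Qed.

Lemma multilinearZ f x i c u :
  multilinear f -> f (upd x i (c *: u)) = c *: f (upd x i u).
Proof.
move=> linf; have lin := linf x i; have f0 : f (upd x i 0) = 0.
  by have := lin (-1) 0 0; rewrite scaler0 addr0 scaleN1r addNr.
by have := lin c u 0; rewrite addr0 f0 addr0.
Qed.

Lemma multilinear_sum f x i (I : finType) (P : pred I) (u : I -> V) :
  multilinear f ->
  f (upd x i (\sum_(j | P j) u j)) = \sum_(j | P j) f (upd x i (u j)).
Proof.
move=> linf; have lin := linf x i.
apply: (big_morph (fun w => f (upd x i w))) => [v w|].
  by have := lin 1 v w; rewrite !scale1r.
by have := lin (-1) 0 0; rewrite scaler0 addr0 scaleN1r addNr.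
Qed.

End Antisymmetrization.

(** * Composites of permuted operations *)

Section Composition.

Variable n : nat.
Implicit Types (f g : {ffun 'I_n.+1 -> V} -> V) (x : {ffun 'I_(n + n).+1 -> V}).
Implicit Types (i j : 'I_n.+1) (s t : 'S_n.+1).

(** Two distinct operations are allowed because expanding a composite of sums pairs different
    permuted copies of [f]. The value at [slot i i] is overwritten by [upd]. *)
Definition comp_at f g i x : V :=
  f (upd [ffun j => x (slot i j)] i (g [ffun k => x (entry i k)])).

Lemma self_compE f i x : self_comp f i x = comp_at f f i x.
Proof.
congr (f _); apply/ffunP=> j; rewrite !ffunE.
have [->|ji] := eqVneq j i; first by rewrite ltnn.
rewrite /slot (leq_eqVlt j) (inj_eq val_inj) (negbTE ji) /=.
by case: ifP.
Qed.

Lemma comp_at_rhol s f j :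
  exists2 B : 'S_(n + n).+1, block_perm j (s j) s B & forall g x,
  comp_at (comp_rho s f) g (s j) x =
    (-1) ^+ ((j + s j) * n) *: comp_rho B (comp_at f g j) x.
Proof.
have [B HB] := block_perm_exists j s; exists B => // g x.
case: HB => _ Bs Be Bo.
rewrite /comp_rho scalerA -[in RHS]signr_odd -signr_addb.
rewrite Bo addbC -addbA addbb addbF; congr (_ *: f _).
apply/ffunP=> k; rewrite !ffunE (inj_eq perm_inj).
have [_|kj] := eqVneq k j.
  by congr g; apply/ffunP=> l; rewrite !ffunE Be.
by rewrite Bs.
Qed.

(** [A] acts as [t] on the block and trivially elsewhere; linearity of [f] in argument [j] pulls the
    sign of [t] out. *)
Lemma comp_at_rhor t f j : multilinear f ->
  exists2 A : 'S_(n + n).+1,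
    j != ord_max \/ t ord_max = ord_max -> A ord_max = ord_max &
  forall g x, comp_at f (comp_rho t g) j x = comp_rho A (comp_at f g j) x.
Proof.
move=> linf; have [A [Ae Afix Ao]] := perm_extension t (@entry_inj n j).
have Amax : j != ord_max -> A ord_max = ord_max.
  by move=> jm; apply: Afix; rewrite -(slot_max jm) slot_notin_entry // eq_sym.
exists A => [[/Amax //|tm]|g x].
  have [jm|/Amax //] := eqVneq j ord_max.
  by rewrite -[in LHS](@entry_max n) -{1}jm Ae jm tm entry_max.
rewrite /comp_at multilinearZ // /comp_rho Ao; congr (_ *: f _).
apply/ffunP=> k; rewrite !ffunE; have [kj|kj] := eqVneq k j.
  by congr g; apply/ffunP=> l; rewrite !ffunE Ae.
by rewrite Afix // slot_notin_entry.
Qed.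

Lemma antisym_self_comp (H : {group 'S_(n + n).+1}) (S : {set 'S_n.+1}) f x :
  multilinear f ->
  (forall B : 'S_(n + n).+1, B ord_max = ord_max -> B \in H) ->
  (forall s, s \in S -> s ord_max = ord_max) \/ H = [set: 'S_(n + n).+1]%G ->
  \sum_(i < n.+1) (-1) ^+ (i * n) *: antisym H (self_comp (antisym S f) i) x =
  antisym H (fun y => \sum_(i < n.+1) (-1) ^+ (i * n) *: self_comp f i y) x
    *+ (#|S| * #|S|).
Proof.
move=> linf stabH hS.
(* Either alternative of [hS] puts every variable permutation that arises into [H], where
   antisymmetrization absorbs it. *)
have memH s (B : 'S_(n + n).+1) : s \in S ->
    (s ord_max = ord_max -> B ord_max = ord_max) -> B \in H.
  by case: hS => [Smax /Smax smax /(_ smax)/stabH|->]; rewrite ?inE.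
have split_sums i y : self_comp (antisym S f) i y =
    \sum_(s in S) \sum_(t in S) comp_at (comp_rho s f) (comp_rho t f) i y.
  rewrite self_compE; apply: eq_bigr => s _.
  exact: multilinear_sum (multilinear_comp_rho _ _).
have absorb s t j : s \in S -> t \in S ->
    antisym H (comp_at (comp_rho s f) (comp_rho t f) (s j)) x =
    (-1) ^+ ((j + s j) * n) *: antisym H (self_comp f j) x.
  move=> Ss St; have [B HB eB] := comp_at_rhol s f j.
  have [A HA eA] := comp_at_rhor t j linf.
  pose F y := (-1) ^+ ((j + s j) * n) *:
    comp_rho B (comp_rho A (comp_at f f j)) y.
  rewrite (@eq_antisym _ _ _ F) => [|y]; last first.
    by rewrite eB; congr (_ *: _); apply: eq_comp_rho.
  rewrite antisymZ !antisym_comp_rho; last 1 first.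
  - exact: (memH s) (block_perm_max HB).
  - by congr (_ *: _); apply: eq_antisym => y; rewrite self_compE.
  - by apply: (memH t) => // tm; apply: HA; right.
transitivity (\sum_(s in S) \sum_(t in S)
    \sum_(j < n.+1) (-1) ^+ (j * n) *: antisym H (self_comp f j) x); last first.
  rewrite !sumr_const mulrnA antisym_sum; congr (_ *+ _ *+ _).
  by apply: eq_bigr => j _; rewrite antisymZ.
under eq_bigr => i _.
  rewrite (eq_antisym _ (split_sums i)) antisym_sum scaler_sumr; over.
rewrite exchange_big; apply: eq_bigr => s Ss.
(* Position [s j] of [comp_rho s f] is argument [j] of [f], so the sum runs over [i = s j]. *)
rewrite (reindex_inj (@perm_inj _ s)).
under eq_bigr => j _ do rewrite antisym_sum scaler_sumr.
rewrite exchange_big; apply: eq_bigr => t St; apply: eq_bigr => j _.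
(* The total exponent [s j * n + (j + s j) * n] has the parity of [j * n]. *)
rewrite absorb // scalerA -exprD mulnDl addnCA addnn.
by rewrite exprD -[X in _ * X]signr_odd odd_double mulr1.
Qed.

End Composition.
Lemma eq_multilinear k (f g : {ffun 'I_k -> V} -> V) :
  f =1 g -> multilinear f -> multilinear g.
Proof. by move=> efg linf x i a u v; rewrite -!efg linf. Qed.

Lemma eq_self_comp n (f g : {ffun 'I_n.+1 -> V} -> V) i :
  f =1 g -> self_comp f i =1 self_comp g i.
Proof. by move=> efg x; rewrite !self_compE /comp_at !efg. Qed.

(** * The stabilizer of the last argument *)

Section LastArgument.

Variable k : nat.
Implicit Types (f : {ffun 'I_k.+1 -> V} -> V) (x : {ffun 'I_k.+1 -> V}).

Definition stab_max : {group 'S_k.+1} := 'C[ord_max | 'P]%G.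

Lemma stab_maxP (s : 'S_k.+1) : reflect (s ord_max = ord_max) (s \in stab_max).
Proof. by apply: (iffP astab1P); rewrite /= apermE. Qed.

Lemma ffun_rcons_permute (s : 'S_k) x :
  ffun_rcons (permute s (ffun_belast x)) (x ord_max) =
  permute (lift_perm ord_max ord_max s) x.
Proof.
apply/ffunP=> i; rewrite !ffunE.
by case: unliftP => [j ->|->]; rewrite ?lift_perm_lift ?lift_perm_id ?ffunE.
Qed.

Lemma comp_tens_id_rho (s : 'S_k) f x :
  comp_tens_id (comp_rho s) f x = comp_rho (lift_perm ord_max ord_max s) f x.
Proof.
rewrite /comp_tens_id /comp_rho ffun_rcons_permute.
by rewrite odd_lift_perm addbb addFb.
Qed.

Lemma sum_lift_perm (i j : 'I_k.+1) (F : 'S_k.+1 -> V) :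
  \sum_(s : 'S_k.+1 | s i == j) F s = \sum_(s : 'S_k) F (lift_perm i j s).
Proof.
(* The [pick] inverts [lift_perm i j]; by [lift_permP] its default is never reached when
   [s i = j]. *)
rewrite (reindex_onto (lift_perm i j)
  (fun s => odflt 1%g [pick t | s == lift_perm i j t])).
  apply: eq_bigl => s; rewrite lift_perm_id eqxx /=.
  by case: pickP => [t /eqP/lift_perm_inj->|/(_ s)]; rewrite eqxx.
move=> s /eqP si; have [t st] := lift_permP i s; rewrite si in st.
by case: pickP => [u /eqP|/(_ t)] //; rewrite st eqxx.
Qed.

Lemma antisym_stab_max f x :
  antisym stab_max f x =
  \sum_(s : 'S_k) comp_rho (lift_perm ord_max ord_max s) f x.
Proof.
rewrite -(sum_lift_perm ord_max ord_max (fun s => comp_rho s f x)).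
apply: eq_bigl => s.
by apply/stab_maxP/eqP.
Qed.

Lemma comp_tens_id_rho_w f x :
  comp_tens_id (@comp_rho_w _ _ k) f x = antisym stab_max f x.
Proof.
by rewrite antisym_stab_max; apply: eq_bigr => s _; rewrite -comp_tens_id_rho.
Qed.

Lemma comp_rho_wE f x : comp_rho_w f x = antisym [set: 'S_k.+1] f x.
Proof. by apply: eq_bigl => s; rewrite inE. Qed.

End LastArgument.

(** * From partially associative to pre-Lie *)

Lemma pre_lie_productE n (m : {ffun 'I_n.+1 -> V} -> V) :
  pre_lie_product m =1 antisym (stab_max n) m.
Proof.
move=> x; rewrite antisym_stab_max; apply: eq_bigr => s _.
by rewrite -comp_tens_id_rho.
Qed.

Lemma partially_associative_pre_lie n (m : {ffun 'I_n.+1 -> V} -> V) :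
  partially_associative m -> pre_lie (pre_lie_product m).
Proof.
move=> [linm assoc]; split.
- apply: eq_multilinear (multilinear_antisym (stab_max n) linm) => x.
  by rewrite pre_lie_productE.
- move=> s x; rewrite comp_tens_id_rho (eq_comp_rho _ (pre_lie_productE m)).
  rewrite pre_lie_productE comp_rho_antisym //.
  by apply/stab_maxP; rewrite lift_perm_id.
move=> x.
transitivity ((n`!%:R ^+ 2)^-1 *: \sum_(i < n.+1) (-1) ^+ (i * n) *:
    antisym (stab_max (n + n)) (self_comp (antisym (stab_max n) m) i) x).
  rewrite scaler_sumr; apply: eq_bigr => i _.
  rewrite scalerA mulrC comp_tens_id_rho_w; congr (_ *: _).
  exact: eq_antisym (eq_self_comp _ (pre_lie_productE m)) _.
rewrite antisym_self_comp //; last first.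
- by left=> s /stab_maxP.
- by move=> B /stab_maxP.
rewrite /antisym big1 ?mul0rn ?scaler0 // => s _.
by rewrite /comp_rho assoc scaler0.
Qed.

(** * Shuffles, and from pre-Lie to Lie *)

(** An increasing permutation dominates the identity, and so does its inverse. *)
Lemma increasing_perm_id n (s : 'S_n) :
  (forall i j : 'I_n, (i < j)%N -> (s i < s j)%N) -> s = 1%g.
Proof.
have ge_id (t : 'S_n) : (forall i j : 'I_n, (i < j)%N -> (t i < t j)%N) ->
    forall i : 'I_n, (i <= t i)%N.
  move=> inc [m]; elim: m => [//|m IHm] ltm /=.
  apply: leq_ltn_trans (IHm (ltnW ltm)) _; exact: inc.
move=> inc; have incV (i j : 'I_n) : (i < j)%N -> (s^-1%g i < s^-1%g j)%N.
  apply: contraTltn; rewrite leq_eqVlt => /predU1P[/val_inj/perm_inj->|/inc].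
    by rewrite ltnn.
  by rewrite !permKV -leqNgt => /ltnW.
apply/permP=> i; rewrite perm1; apply: val_inj; apply/eqP.
by rewrite eqn_leq ge_id // andbT; have := ge_id _ incV (s i); rewrite permK.
Qed.

(** With the last index and its image removed, a shuffle becomes an increasing permutation, hence
    the identity. *)
Lemma in_shuffles n (s : 'S_n.+1) :
  (s \in shuffles n) = (s == lift_perm ord_max (s ord_max) 1).
Proof.
have [t ->] := lift_permP ord_max s; rewrite lift_perm_id.
rewrite (inj_eq (@lift_perm_inj _ _ _)) inE.
apply/'forall_'forall_implyP/eqP => [inc|-> i j /andP[ij jn]].
  apply: increasing_perm_id => i j ij.
  have := inc (lift ord_max i) (lift ord_max j).
  by rewrite !lift_max ij ltn_ord !lift_perm_lift !ltnNge leq_bump2; apply.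
have notmax (l : 'I_n.+1) : (l < n)%N -> exists r, l = lift ord_max r.
  move=> ln; have : ord_max != l by rewrite -val_eqE /= gtn_eqF.
  by case/unlift_some=> r -> _; exists r.
have [[a ia] [b jb]] := (notmax i (ltn_trans ij jn), notmax j jn).
rewrite ia jb !lift_perm_lift !perm1 ltnNge leq_bump2 -ltnNge.
by move: ij; rewrite ia jb !lift_max.
Qed.

Lemma antisym_lie_product n (p : {ffun 'I_n.+1 -> V} -> V) x :
  (forall s : 'S_n, p =1 comp_tens_id (comp_rho s) p) ->
  antisym [set: 'S_n.+1] p x = lie_product p x *+ n`!.
Proof.
move=> symp.
rewrite /antisym (partition_big (fun s : 'S_n.+1 => s ord_max) xpredT) //=.
rewrite [lie_product p x](partition_big
  (fun s : 'S_n.+1 => s ord_max) xpredT) //=.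
rewrite -sumrMnl; apply: eq_bigr => j _.
under eq_bigl => s do rewrite inE /=.
rewrite sum_lift_perm (big_pred1 (lift_perm ord_max j 1)) => [|s]; last first.
  rewrite in_shuffles; apply/andP/eqP => [[/eqP sE /eqP <-//]|->].
  by rewrite lift_perm_id !eqxx.
rewrite -card_Sn -sumr_const; apply: eq_bigr => s _.
rewrite -[X in lift_perm _ _ X]mulg1 -(lift_permM _ ord_max) comp_rhoM.
by apply: eq_comp_rho => y; rewrite -comp_tens_id_rho -symp.
Qed.

Lemma pre_lie_lie n (p : {ffun 'I_n.+1 -> V} -> V) :
  [pchar K] =i pred0 -> pre_lie p -> lie (lie_product p).
Proof.
move=> /pcharf0P charK [linp symp prelie].
have natr_inj0 l (v : V) : (0 < l)%N -> v *+ l = 0 -> v = 0.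
  move=> l0; rewrite -scaler_nat => /eqP; rewrite scaler_eq0 charK.
  by rewrite eqn0Ngt l0 => /eqP.
(* [lie_product p] is convertible to [antisym (shuffles n) p]. *)
split; first exact: multilinear_antisym linp.
  move=> s x; apply/eqP; rewrite -subr_eq0; apply/eqP.
  apply: (natr_inj0 n`!); first exact: fact_gt0.
  rewrite mulrnBl -antisym_lie_product //.
  rewrite -(@comp_rho_antisym _ [set: 'S_n.+1]%G s) ?inE //.
  by rewrite /comp_rho antisym_lie_product // scalerMnr subrr.
move=> x.
transitivity ((n`!%:R * (n.+1)`!%:R)^-1 *: \sum_(i < n.+1) (-1) ^+ (i * n) *:
    antisym [set: 'S_(n + n).+1] (self_comp (antisym (shuffles n) p) i) x).
  rewrite scaler_sumr; apply: eq_bigr => i _.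
  by rewrite scalerA mulrC comp_rho_wE.
rewrite (@antisym_self_comp _ [set: _]%G) //; last first.
- by right.
- by move=> B _; rewrite inE.
set F := fun y => _.
have antisymF0 y : antisym (stab_max (n + n)) F y = 0.
  have /(congr1 ( *:%R (n`!%:R ^+ 2))) := prelie y.
  rewrite scaler0 scaler_sumr => scaled0.
  rewrite -[RHS]scaled0 antisym_sum; apply: eq_bigr => i _.
  rewrite antisymZ comp_tens_id_rho_w scalerA mulrCA divff ?mulr1 //.
  by rewrite expf_neq0 // charK -lt0n fact_gt0.
suff -> : antisym [set: 'S_(n + n).+1] F x = 0 by rewrite mul0rn scaler0.
apply: (natr_inj0 #|stab_max (n + n)|); first exact: cardG_gt0.
rewrite -sumr_const.
(* Full antisymmetrization absorbs each stabilizer element, so averaging over the stabilizer first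
   only multiplies by its order. *)
transitivity (antisym [set: 'S_(n + n).+1] (antisym (stab_max (n + n)) F) x).
  rewrite (@antisym_sum _ _ (mem (stab_max (n + n))) _ (fun s => comp_rho s F)).
  by apply: eq_bigr => s _; rewrite (@antisym_comp_rho _ [set: _]%G) ?inE.
by apply: big1 => s _; rewrite /comp_rho antisymF0 scaler0.
Qed.

End Multilinear.

Theorem corollary4p5 (K : fieldType) (charK : [pchar K] =i pred0)
    (V : lmodType K) (n : nat) :
  (forall m : {ffun 'I_n.+1 -> V} -> V,
     partially_associative m -> pre_lie (pre_lie_product m)) /\
  (forall p : {ffun 'I_n.+1 -> V} -> V,
     pre_lie p -> lie (lie_product p)).
Proof.
by split=> [m|p]; [apply: partially_associative_pre_lie | apply: pre_lie_lie].
Qed.
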